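(* Fix $d\ge2$ and put $q=\frac{2d}{d+1}$. There are $d$-linear forms $T_t:(\mathbb R^2)^d\to\mathbb R$, $0<t<1/2$, such that \[ \|T_t\|_{\mathrm{cb}}=1,\qquad 1-\|T_t\|_q=\frac{t^2}{d+1}+O_d(t^4), \] and there is a constant $c_d>0$ depending only on $d$ such that, for all sufficiently small $t$, every real normalized unitary chain $Q$ and every real normalized flat unimodular path $P$ supported on an equal-sided Cartesian box in $[2]^d$ satisfy $\|T_t-Q\|_q\ge c_dt$ and $\|T_t-P\|_q\ge c_dt$. The same lower bound holds when the approximants $Q$, $P$ are allowed to be complex, after viewing $T_t$ as a complex multilinear form. Consequently, no uniform estimate for either structural approximation can have deficit exponent greater than $1/2$: for $\mathbb K\in\{\mathbb R,\mathbb C\}$ and any $\alpha>1/2$, there are no constants $C<\infty$ and $\varepsilon_0>0$ (depending only on $d$ and $\alpha$) such that for every $n\ge1$, every $0\le\varepsilon\le\varepsilon_0$ and every $d$-linear form $T:(\mathbb K^n)^d\to\mathbb K$ with $\|T\|_{\mathrm{cb}}=1$ and $\|T\|_q\ge1-\varepsilon$ there is a normalized unitary chain $Q$ over $\mathbb K$ on an equal-sided Cartesian box in $[n]^d$ with $\|T-Q\|_q\le C\varepsilon^\alpha$; and the same is true with ''normalized flat unimodular path $P$'' in place of ''normalized unitary chain $Q$''.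
   Context: $[n]=\{1,\dots,n\}$ and $e_1,\dots,e_n$ is the canonical basis of $\mathbb K^n$, $\mathbb K\in\{\mathbb R,\mathbb C\}$. The coefficient norm of a $d$-linear form is $\|T\|_q=\big(\sum_{i_1,\ldots,i_d=1}^n|T(e_{i_1},\ldots,e_{i_d})|^q\big)^{1/q}$. The completely bounded norm is \[ \|T\|_{\mathrm{cb}}=\sup_{\mathcal H}\ \sup_{(X_j^s)}\Big\|\sum_{i_1,\ldots,i_d=1}^n T(e_{i_1},\ldots,e_{i_d})\,X^1_{i_1}\cdots X^d_{i_d}\Big\|_{\mathcal B(\mathcal H)}, \] where $\mathcal H$ ranges over all Hilbert spaces over $\mathbb K$ and $(X_j^s)_{s\in[d],\,j\in[n]}$ over all families of bounded operators on $\mathcal H$ with operator norm $\le1$ (not necessarily commuting). When $\|T\|_{\mathrm{cb}}=1$, the deficit of $T$ is $1-\|T\|_q$. An equal-sided Cartesian box in $[n]^d$ is $J=J_1\times\cdots\times J_d$ with $J_s\subseteq[n]$ and $|J_1|=\cdots=|J_d|=m\ge1$. A normalized unitary chain on $J$ is a form with coefficients $m^{-1}\prod_{r=1}^{d-1}U_r(i_r,i_{r+1})$ on $J$ and zero outside $J$, where $U_r$ are unitary matrices (orthogonal over $\mathbb R$) indexed by $J_r\times J_{r+1}$. A normalized flat unimodular path on $J$ is a form with coefficients $m^{-(d+1)/2}\prod_{r=1}^{d-1}H_r(i_r,i_{r+1})$ on $J$ and zero outside $J$, where the $H_r$ are matrices indexed by $J_r\times J_{r+1}$ with all entries of modulus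 one. $O_d(t^4)$ denotes a quantity bounded in absolute value by $C_dt^4$ with $C_d$ depending only on $d$. *)

(* Defs.v *)
From HB Require Import structures.
From mathcomp Require Import all_boot all_order all_algebra.
From mathcomp Require Import complex.
From mathcomp Require Import all_classical all_reals all_analysis.

Set Implicit Arguments.
Unset Strict Implicit.
Unset Printing Implicit Defensive.

Import Order.TTheory GRing.Theory Num.Theory.
Import numFieldNormedType.Exports.

Local Open Scope classical_set_scope.
Local Open Scope ring_scope.

Variant scalars := RealScalars | ComplexScalars.

Section Scalars.
Variable R : realType.

Definition field_of (k : scalars) : numFieldType :=
  match k with RealScalars => R | ComplexScalars => R[i] end.

Definition of_real (k : scalars) : R -> field_of k :=
  match k with RealScalars => fun x => x | ComplexScalars => fun x => x%:C%C end.

Definition real_part (k : scalars) : field_of k -> R :=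
  match k with RealScalars => fun x => x | ComplexScalars => @complex.Re R end.

Definition conjugate (k : scalars) : {rmorphism field_of k -> field_of k} :=
  match k with RealScalars => idfun | ComplexScalars => @conjc R end.

(* The library's norm over R[i] takes its values in R[i]; this is the same norm
   with values in R. *)
Definition rnorm (k : scalars) (V : normedZmodType (field_of k)) (x : V) : R :=
  real_part `|x|.

End Scalars.

Section MultilinearForms.
Variables (R : realType) (k : scalars) (n d : nat).
Local Notation K := (field_of R k).

Definition multilinear (T : ('I_d -> 'rV[K]_n) -> K) : Prop :=
  forall (x : 'I_d -> 'rV[K]_n) (s : 'I_d) (a : K) (u v : 'rV[K]_n),
    T (dfwith x s (a *: u + v)) = a * T (dfwith x s u) + T (dfwith x s v).

Record mform := MForm {
  mform_fun :> ('I_d -> 'rV[K]_n) -> K;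
  mform_multilinear : multilinear mform_fun }.

Definition coef (T : ('I_d -> 'rV[K]_n) -> K) (i : {ffun 'I_d -> 'I_n}) : K :=
  T (fun s => delta_mx 0 (i s)).

Definition form_of_coef (c : {ffun 'I_d -> 'I_n} -> K)
    (x : 'I_d -> 'rV[K]_n) : K :=
  \sum_(i : {ffun 'I_d -> 'I_n}) c i * \prod_(s < d) x s 0 (i s).

Lemma form_of_coef_multilinear c : multilinear (form_of_coef c).
Proof.
move=> x s a u v; rewrite /form_of_coef mulr_sumr -big_split /=.
apply: eq_bigr => i _.
have E w : \prod_(t < d) dfwith x s w t 0 (i t) =
    w 0 (i s) * \prod_(t < d | t != s) x t 0 (i t).
  rewrite (bigD1 s) //= dfwithin; congr (_ * _).
  by apply: eq_bigr => t ts; rewrite dfwithout // eq_sym.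
by rewrite !E !mxE mulrDl mulrDr !mulrA (mulrC (c i) a).
Qed.

Lemma coef_form_of_coef c i : coef (form_of_coef c) i = c i.
Proof.
rewrite /coef /form_of_coef (bigD1 i) //= big1 ?mulr1 => [|s _]; last first.
  by rewrite mxE !eqxx.
rewrite big1 ?addr0 // => j ji.
have [s jis] : exists s, j s != i s.
  by apply/existsP; apply: contraNT ji; rewrite negb_exists => /forallP h;
    apply/eqP/ffunP => s; apply/eqP; move: (h s); rewrite negbK.
by rewrite (bigD1 s) //= mxE eqxx /= (negbTE jis) mul0r mulr0.
Qed.

Definition coef_norm (q : R) (T : ('I_d -> 'rV[K]_n) -> K) : R :=
  (\sum_(i : {ffun 'I_d -> 'I_n}) (rnorm (coef T i : K)) `^ q) `^ q^-1.

End MultilinearForms.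

Definition complexify (R : realType) (n d : nat)
    (T : mform R RealScalars n d) : mform R ComplexScalars n d :=
  MForm (form_of_coef_multilinear
    (fun i => of_real ComplexScalars (coef T i))).

Section CompletelyBoundedNorm.
Variables (R : realType) (k : scalars).
Local Notation K := (field_of R k).

Record hilbertSpace := HilbertSpace {
  hilbert_sort :> completeNormedModType K;
  inner : {dot hilbert_sort for conjugate R k};
  hilbert_normE : forall x : hilbert_sort, `|x| ^+ 2 = inner x x }.

Definition opnorm (H : hilbertSpace) (X : H -> H) : \bar R :=
  ereal_sup [set (rnorm (X x))%:E | x in [set x : H | rnorm x <= 1]].

Variables (n d : nat).

Definition operator_value (T : mform R k n d) (H : hilbertSpace)
    (X : 'I_d -> 'I_n -> {linear H -> H}) (v : H) : H :=
  \sum_(i : {ffun 'I_d -> 'I_n})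
    coef T i *: (\big[comp/idfun]_(s < d) (X s (i s) : H -> H)) v.

Definition cb_norm (T : mform R k n d) : \bar R :=
  ereal_sup [set r | exists (H : hilbertSpace)
                       (X : 'I_d -> 'I_n -> {linear H -> H}),
      (forall s j, (opnorm (X s j) <= 1)%E) /\
      r = opnorm (operator_value T X)].

End CompletelyBoundedNorm.

Section StructuredForms.
Variables (R : realType) (k : scalars) (n d : nat).
Local Notation K := (field_of R k).

(* A matrix indexed by A x B is represented by a function on 'I_n x 'I_n whose
   values off A x B are irrelevant. *)
Definition unitary_on (A B : {set 'I_n}) (U : 'I_n -> 'I_n -> K) : Prop :=
  {in A &, forall a a',
     \sum_(b in B) U a b * conjugate R k (U a' b) = (a == a')%:R} /\
  {in B &, forall b b',
     \sum_(a in A) conjugate R k (U a b) * U a b' = (b == b')%:R}.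

Definition unimodular_on (A B : {set 'I_n}) (H : 'I_n -> 'I_n -> K) : Prop :=
  {in A & B, forall a b, rnorm (H a b : K) = 1}.

Definition equal_sided_box (m : nat) (J : 'I_d -> {set 'I_n}) : Prop :=
  (1 <= m)%N /\ forall s, #|J s| = m.

(* Here r ranges over the indices having a successor, and [ordS r] is r + 1. *)
Definition path_prod (U : 'I_d -> 'I_n -> 'I_n -> K)
    (i : {ffun 'I_d -> 'I_n}) : K :=
  \prod_(r < d | (r.+1 < d)%N) U r (i r) (i (ordS r)).

Definition unitary_chain (Q : mform R k n d) : Prop :=
  exists (m : nat) (J : 'I_d -> {set 'I_n}) (U : 'I_d -> 'I_n -> 'I_n -> K),
    [/\ equal_sided_box m J,
        forall r : 'I_d, (r.+1 < d)%N -> unitary_on (J r) (J (ordS r)) (U r) &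
        forall i, coef Q i =
          if [forall s, i s \in J s] then m%:R^-1 * path_prod U i else 0].

Definition flat_unimodular_path (P : mform R k n d) : Prop :=
  exists (m : nat) (J : 'I_d -> {set 'I_n}) (H : 'I_d -> 'I_n -> 'I_n -> K),
    [/\ equal_sided_box m J,
        forall r : 'I_d, (r.+1 < d)%N ->
          unimodular_on (J r) (J (ordS r)) (H r) &
        forall i, coef P i =
          if [forall s, i s \in J s]
          then of_real k (m%:R `^ (- (d.+1%:R / 2))) * path_prod H i else 0].

End StructuredForms.

Section UniformEstimate.
Variables (R : realType) (k : scalars) (d : nat).

Definition uniform_estimate (q alpha : R)
    (S : forall n, mform R k n d -> Prop) : Prop :=
  exists C eps0 : R, 0 < eps0 /\
    forall (n : nat) (eps : R) (T : mform R k n d),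
      (1 <= n)%N -> 0 <= eps <= eps0 ->
      cb_norm T = 1%E -> 1 - eps <= coef_norm q T ->
      exists Q : mform R k n d,
        S n Q /\ coef_norm q (T \- Q) <= C * eps `^ alpha.

End UniformEstimate.

(* Main.v *)
Require Import Defs.
From HB Require Import structures.
From mathcomp Require Import all_boot all_order all_algebra.
From mathcomp Require Import ring lra zify.
From mathcomp Require Import complex.
From mathcomp Require Import all_classical all_reals all_analysis.

Set Implicit Arguments.
Unset Strict Implicit.
Unset Printing Implicit Defensive.

Import Order.TTheory GRing.Theory Num.Theory.
Import numFieldNormedType.Exports.
Local Open Scope ring_scope.

(** The forms are Hadamard chains with a tilted first vector.  Write
    [h j l = (-1)^(jl)], so that [h / sqrt 2] is a unitary 2 x 2 matrix, and
    let [a_0, a_1] be the square roots of [1/2 + t, 1/2 - t].  The form [T_t]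
    has coefficients

      a_(i_0) * sqrt 2 ^ (-d) * h(i_0, i_1) * ... * h(i_(d-2), i_(d-1)).

    At [t = 0] this is a flat unitary chain, for which the [q]-norm is exactly
    one; the tilt costs only [t^2] in the [q]-norm but moves the moduli of the
    coefficients by an amount of order [t].

    Completely bounded norm.  For contractions [X_s(j)] and a vector [v], the
    vectors obtained by summing over the indices to the right of position [s]
    satisfy a recursion [Y_s(j) = sum_l h(j,l) X_(s+1)(l) Y_(s+1)(l)]
    ([chainS]).  The parallelogram law shows that each step at most doubles
    [|Y(0)|^2 + |Y(1)|^2] ([sum_chain_le]); the Cauchy-Schwarz inequality
    against the unit vector [(a_0, a_1)] then gives norm at most one.  For the
    converse, let the complex plane, seen as a Hilbert space over either scalar
    field, carry rotations [X_s(j)].  Rotations adjust the two phases at will,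
    so all intermediate pairs can be kept balanced, with [|Y(0)| = |Y(1)|]
    ([exists_balanced]), and a last angle of cosine [2t] makes [|Y(0)|, |Y(1)|]
    proportional to [a_0, a_1] ([operator_value_tilted_attained]): every
    inequality above becomes an equality.  The same operators serve over both
    fields, so the complexified form also has norm one.

    Deficit.  With [p = d/(d+1) = q/2] the norm of [T_t] is the power
    [(d+1)/(2d)] of [((1+2t)^p + (1-2t)^p) / 2].  All exponents being rational,
    its expansion is found by algebra alone: if the same integer powers of a
    nonnegative function and of one bounded away from zero agree modulo [x^4],
    then so do the functions ([jet3_eq_root]), and powers of cubic polynomials
    are computed modulo [x^4] by induction ([cubicX_jet]).

    Distance.  Every unitary chain and every flat path on a box has a
    coefficient with first index 0 and modulus at most [sqrt 2 ^ (-(d+1))]: a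
    box of side one misses an index, a flat path on the full box has all moduli
    equal to that number, and in a unitary chain on the full box an entry of
    modulus at most [1 / sqrt 2] can be chosen in each row along the path
    ([unitary_chain_small_coef]).  The corresponding coefficient of [T_t] is
    larger by the factor [sqrt (1 + 2t)], hence the lower bound [c t]
    ([tilted_far]).  A uniform estimate of exponent [alpha > 1/2], applied with
    deficit of order [t^2], would bound [c t] by a multiple of [t^(2 alpha)],
    which fails as [t] tends to 0 ([no_uniform_estimate]). *)

(** * Scalars and their real-valued norm *)

Notation normc := ComplexField.Normc.normc.
Arguments of_real {R} k.
Arguments real_part {R} k.

Section ScalarField.
Variables (R : realType) (k : scalars).
Local Notation K := (field_of R k).

Lemma of_real_is_additive : zmod_morphism (of_real k : R -> K).
Proof. by case: k => x y //=; rewrite rmorphB. Qed.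

Lemma of_real_is_multiplicative : monoid_morphism (of_real k : R -> K).
Proof. by case: k; split=> //= x y; rewrite rmorphM. Qed.

HB.instance Definition _ := GRing.isZmodMorphism.Build R K (of_real k)
  of_real_is_additive.
HB.instance Definition _ := GRing.isMonoidMorphism.Build R K (of_real k)
  of_real_is_multiplicative.

Lemma real_part_is_additive : zmod_morphism (real_part k : K -> R).
Proof. by case: k => x y //=; rewrite raddfB. Qed.

HB.instance Definition _ := GRing.isZmodMorphism.Build K R (real_part k)
  real_part_is_additive.

Lemma of_realK : cancel (of_real k) (real_part k : K -> R).
Proof. by case: k. Qed.

Lemma real_partK (x : K) : 0 <= x -> of_real k (real_part k x) = x.
Proof.
case: k x => //= x /ger0_real; exact: RRe_real.
Qed.

Lemma ler_of_real (x y : R) : ((of_real k x : K) <= of_real k y) = (x <= y).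
Proof. by case: k => //=; rewrite lecR. Qed.

Lemma norm_of_real (x : R) : `|of_real k x : K| = of_real k `|x|.
Proof. by case: k => //=; rewrite normc_def /= expr0n addr0 sqrtr_sqr. Qed.

Lemma ltr_of_real (x y : R) : ((of_real k x : K) < of_real k y) = (x < y).
Proof. by case: k => //=; rewrite ltcR. Qed.

Section Norm.
Variable V : normedZmodType K.
Implicit Types x y : V.

Lemma of_rnorm x : of_real k (rnorm x) = `|x|.
Proof. exact: real_partK. Qed.

Lemma rnorm_ge0 x : 0 <= rnorm x.
Proof. by rewrite -ler_of_real of_rnorm rmorph0. Qed.

Lemma ler_rnormD x y : rnorm (x + y) <= rnorm x + rnorm y.
Proof. by rewrite -ler_of_real rmorphD /= !of_rnorm ler_normD. Qed.

Lemma ler_rnorm_sum (I : finType) (F : I -> V) :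
  rnorm (\sum_i F i) <= \sum_i rnorm (F i).
Proof.
rewrite -ler_of_real rmorph_sum /= of_rnorm (le_trans (ler_norm_sum _ _ _))//.
by apply: ler_sum => i _; rewrite of_rnorm.
Qed.

Lemma rnorm0 : rnorm (0 : V) = 0.
Proof. by rewrite /rnorm normr0 raddf0. Qed.

End Norm.

Lemma rnormM (x y : K) : rnorm (x * y) = rnorm x * rnorm y.
Proof. by apply: (can_inj of_realK); rewrite rmorphM /= !of_rnorm normrM. Qed.

Lemma rnorm_of_real (x : R) : rnorm (of_real k x : K) = `|x|.
Proof. by apply: (can_inj of_realK); rewrite of_rnorm norm_of_real. Qed.

Lemma rnormZ (V : normedModType K) (a : K) (x : V) :
  rnorm (a *: x) = rnorm a * rnorm x.
Proof. by apply: (can_inj of_realK); rewrite rmorphM /= !of_rnorm normrZ. Qed.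

Lemma rnorm_prod (I : finType) (P : pred I) (F : I -> K) :
  rnorm (\prod_(i | P i) F i) = \prod_(i | P i) rnorm (F i).
Proof.
apply: (can_inj of_realK); rewrite of_rnorm normr_prod rmorph_prod /=.
by apply: eq_bigr => i _; rewrite of_rnorm.
Qed.

End ScalarField.

(** * The complex plane as a Hilbert space over either field *)

Section Plane.
Variables (R : realType) (k : scalars).
Local Notation K := (field_of R k).

(** Scalars act on the plane through [embed], and the scalar-valued inner
    product is the [proj]ection of the complex one: over the reals this is the
    Euclidean plane, over the complex numbers the one-dimensional space. *)
Definition embed : K -> R[i] :=
  match k with
  | RealScalars => fun x => x%:C%C
  | ComplexScalars => fun x => x
  end.

Definition proj : R[i] -> K :=
  match k with RealScalars => @complex.Re R | ComplexScalars => fun x => x end.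

Lemma embed_is_additive : zmod_morphism embed.
Proof. by rewrite /embed; case: k => x y //=; rewrite rmorphB. Qed.

Lemma embed_is_multiplicative : monoid_morphism embed.
Proof. by rewrite /embed; case: k; split=> //= x y; rewrite rmorphM. Qed.

HB.instance Definition _ := GRing.isZmodMorphism.Build K R[i] embed
  embed_is_additive.
HB.instance Definition _ := GRing.isMonoidMorphism.Build K R[i] embed
  embed_is_multiplicative.

Lemma proj_is_additive : zmod_morphism proj.
Proof. by rewrite /proj; case: k => x y //=; rewrite raddfB. Qed.

HB.instance Definition _ := GRing.isZmodMorphism.Build R[i] K proj
  proj_is_additive.

Lemma projZ (a : K) (z : R[i]) : proj (embed a * z) = a * proj z.
Proof.
by rewrite /proj /embed; case: k a z => // a [x y] /=; rewrite !mul0r subr0.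
Qed.

Lemma embed_of_real (x : R) : embed (of_real k x) = x%:C%C.
Proof. by rewrite /embed; case: k. Qed.

Lemma proj_real (x : R) : proj x%:C%C = of_real k x.
Proof. by rewrite /proj; case: k. Qed.

Lemma projJ (z : R[i]) : proj (conjc z) = conjugate R k (proj z).
Proof. by rewrite /proj; case: k z => [[]|]. Qed.

Lemma embedJ (a : K) : conjc (embed a) = embed (conjugate R k a).
Proof. by rewrite /embed; case: k a => [a|//]; rewrite /= -[RHS]conjc_real. Qed.

Lemma normc_embed (a : K) : of_real k (normc (embed a)) = `|a|.
Proof.
rewrite /embed; case: k a => [a|[]] //=.
by rewrite expr0n addr0 sqrtr_sqr.
Qed.

Definition plane : Type := R[i].

HB.instance Definition _ := GRing.Zmodule.on plane.

Definition plane_scale (a : K) (z : plane) : plane := embed a * (z : R[i]).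

Lemma plane_scaleA (a b : K) (z : plane) :
  plane_scale a (plane_scale b z) = plane_scale (a * b) z.
Proof. by rewrite /plane_scale rmorphM mulrA. Qed.

Lemma plane_scale1 : left_id 1 plane_scale.
Proof. by move=> z; rewrite /plane_scale rmorph1 mul1r. Qed.

Lemma plane_scaleDr : right_distributive plane_scale +%R.
Proof. by move=> a x y; rewrite /plane_scale -mulrDr. Qed.

Lemma plane_scaleDl (z : plane) : {morph plane_scale^~ z : a b / a + b}.
Proof. by move=> a b; rewrite /plane_scale rmorphD mulrDl. Qed.

HB.instance Definition _ := GRing.Zmodule_isLmodule.Build K plane
  plane_scaleA plane_scale1 plane_scaleDr plane_scaleDl.

Definition plane_norm (z : plane) : K := of_real k (normc (z : R[i])).

Lemma plane_normD (x y : plane) :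
  plane_norm (x + y) <= plane_norm x + plane_norm y.
Proof. by rewrite /plane_norm -rmorphD ler_of_real le_normcD. Qed.

Lemma plane_normZ (a : K) (z : plane) :
  plane_norm (a *: z) = `|a| * plane_norm z.
Proof.
by rewrite /plane_norm -normc_embed -rmorphM -ComplexField.Normc.normcM.
Qed.

Lemma plane_norm0_eq0 (z : plane) : plane_norm z = 0 -> z = 0.
Proof.
move=> z0; apply: (@ComplexField.Normc.eq0_normc R).
by rewrite -[LHS](@of_realK R k) -/(plane_norm z) z0 raddf0.
Qed.

HB.instance Definition _ := Lmodule_isNormed.Build K plane
  plane_normD plane_normZ plane_norm0_eq0.

Lemma rnorm_plane (z : plane) : rnorm z = normc (z : R[i]).
Proof. by rewrite /rnorm; apply: of_realK. Qed.

Lemma normc_Re (z : R[i]) : `|complex.Re z| <= normc z.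
Proof. by case: z => a b /=; rewrite -sqrtr_sqr ler_wsqrtr// lerDl sqr_ge0. Qed.

Lemma normc_Im (z : R[i]) : `|complex.Im z| <= normc z.
Proof. by case: z => a b /=; rewrite -sqrtr_sqr ler_wsqrtr// lerDr sqr_ge0. Qed.

Lemma normc_le (z : R[i]) : normc z <= `|complex.Re z| + `|complex.Im z|.
Proof.
case: z => a b /=; rewrite -[leRHS]ger0_norm ?addr_ge0// -sqrtr_sqr.
apply: ler_wsqrtr; rewrite sqrrD !real_normK ?num_real// lerD2r lerDl.
by rewrite mulrn_wge0// mulr_ge0.
Qed.

Local Open Scope classical_set_scope.

(** Both cases reduce to completeness of the real line: the coordinate maps are
    contractions, and the norm is at most the sum of the moduli of the
    coordinates. *)
Lemma plane_complete (F : set_system plane) :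
  ProperFilter F -> cauchy F -> cvg F.
Proof.
move=> FF /cauchyP Fc.
have coord (f : R[i] -> R) :
    (forall x y, `|f x - f y| <= normc (x - y)) -> cvg ((f : plane -> R) @ F).
  move=> fl; apply: R_complete; apply/cauchyP => e e0.
  have [|x Fx] := Fc (of_real k e).
    by rewrite -(rmorph0 (of_real k)) ltr_of_real.
  exists (f x); change (F (f @^-1` ball (f x) e)).
  apply: filterS Fx => y; rewrite /= -!ball_normE /= => xy.
  by apply: (le_lt_trans (fl _ _)); rewrite -(ltr_of_real k).
have /cvg_ex[a Fa] : cvg ((@complex.Re R : plane -> R) @ F).
  by apply: coord => x y; rewrite -raddfB normc_Re.
have /cvg_ex[b Fb] : cvg ((@complex.Im R : plane -> R) @ F).
  by apply: coord => x y; rewrite -raddfB normc_Im.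
apply/cvg_ex; exists (Complex a b : plane); apply/cvgrPdist_lt => e e0.
have eE := real_partK (ltW e0).
have r0 : 0 < real_part k e / 2.
  by rewrite divr_gt0// -(ltr_of_real k) eE rmorph0.
move/cvgrPdist_lt/(_ _ r0): Fa => Fa; move/cvgrPdist_lt/(_ _ r0): Fb => Fb.
near=> z; rewrite -of_rnorm -eE ltr_of_real rnorm_plane.
rewrite (le_lt_trans (normc_le _))// [ltRHS]splitr ltrD//.
- by rewrite raddfB /=; near: z.
- by rewrite raddfB /=; near: z.
Unshelve. all: by end_near. Qed.

HB.instance Definition _ := Uniform_isComplete.Build plane plane_complete.

Definition plane_inner (x y : plane) : K :=
  proj ((x : R[i]) * conjc (y : R[i])).

Lemma plane_inner_bilinear :
  bilinear_for *%R (conjugate R k \; *%R) plane_inner.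
Proof.
split=> [y a u v|x a u v]; rewrite /plane_inner /=.
  by rewrite -[a *: u]/(embed a * u) mulrDl raddfD /= -mulrA projZ.
rewrite -[a *: u]/(embed a * u) rmorphD rmorphM mulrDr raddfD /=.
by rewrite embedJ mulrCA projZ.
Qed.

HB.instance Definition _ := bilinear_isBilinear.Build K plane plane K
  *%R (conjugate R k \; *%R) plane_inner plane_inner_bilinear.

Lemma plane_inner_hermitian (x y : plane) :
  plane_inner x y = (-1) ^+ false * conjugate R k (plane_inner y x).
Proof. by rewrite mul1r /plane_inner -projJ rmorphM /= conjcK mulrC. Qed.

HB.instance Definition _ := isHermitianSesquilinear.Build K plane false
  (conjugate R k) plane_inner plane_inner_hermitian.

Lemma plane_normE (x : plane) : `|x| ^+ 2 = plane_inner x x.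
Proof.
have -> : `|x| = of_real k (normc (x : R[i])) by [].
have normE (z : R[i]) : `|z| = (normc z)%:C%C by case: z.
by rewrite /plane_inner -sqr_normc normE -!rmorphXn proj_real.
Qed.

Lemma plane_inner_gt0 (x : plane) : x != 0 -> 0 < plane_inner x x.
Proof. by move=> x0; rewrite -plane_normE exprn_gt0// normr_gt0. Qed.

HB.instance Definition _ := isDotProduct.Build K plane plane_inner
  plane_inner_gt0.

Definition plane_hilbert : hilbertSpace R k :=
  @HilbertSpace R k plane plane_inner plane_normE.

End Plane.

(** * The tilted Hadamard form and its norm bound *)

Section FiniteFunctions.
Variables (I : finType) (n : nat).

Definition ffcons (j : I) (i : {ffun 'I_n -> I}) : {ffun 'I_n.+1 -> I} :=
  [ffun s => if unlift ord0 s is Some s' then i s' else j].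

Lemma ffcons0 j i : ffcons j i ord0 = j.
Proof. by rewrite ffunE unlift_none. Qed.

Lemma ffcons_lift j i s : ffcons j i (lift ord0 s) = i s.
Proof. by rewrite ffunE liftK. Qed.

Lemma big_ffun_recl (V : nmodType) (F : {ffun 'I_n.+1 -> I} -> V) :
  \sum_i F i = \sum_j \sum_i F (ffcons j i).
Proof.
rewrite pair_big /=
  (reindex (fun p : I * {ffun 'I_n -> I} => ffcons p.1 p.2)) //=.
exists (fun i => (i ord0, [ffun s => i (lift ord0 s)])) => [[j i] _|i _] /=.
  congr pair; first exact: ffcons0.
  by apply/ffunP => s; rewrite ffunE ffcons_lift.
apply/ffunP => s; rewrite ffunE; case: unliftP => [s' ->|->//].
by rewrite ffunE.
Qed.

End FiniteFunctions.

Lemma big_ffun0 (I : finType) (V : nmodType) (F : {ffun 'I_0 -> I} -> V) :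
  exists i, \sum_i F i = F i.
Proof.
have i0 : {ffun 'I_0 -> I} by apply: finfun => -[].
exists i0; rewrite (bigD1 i0)//= big1 ?addr0// => i.
by case/negP; apply/eqP/ffunP => -[].
Qed.

Section HadamardPath.
Variable R : realType.

Definition hadamard (j l : 'I_2) : R := (-1) ^+ (j * l).

(** The signs along the path that starts at a given first index; recursion on
    the first step matches the recursion satisfied by partial operator sums. *)
Fixpoint hpath n : 'I_2 -> ('I_n -> 'I_2) -> R :=
  if n is n'.+1 then
    fun j i => hadamard j (i ord0) * hpath (i ord0) (fun s => i (lift ord0 s))
  else fun _ _ => 1.

Lemma norm_hpath n j (i : 'I_n -> 'I_2) : `|hpath j i| = 1.
Proof.
elim: n j i => [|n IH] j i /=; first exact: normr1.
by rewrite normrM IH mulr1 normrX normrN1 expr1n.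
Qed.

Definition weight (t : R) (j : 'I_2) : R := Num.sqrt (1 / 2 + (-1) ^+ j * t).

Definition tilted_coef n (t : R) (i : {ffun 'I_n.+1 -> 'I_2}) : R :=
  weight t (i ord0) * Num.sqrt 2 ^- n.+1
    * hpath (i ord0) (fun s => i (lift ord0 s)).

Definition tilted_form k n t : mform R k 2 n.+1 :=
  MForm (form_of_coef_multilinear (fun i => of_real k (@tilted_coef n t i))).

Lemma coef_tilted_form k n t i :
  coef (tilted_form k n t) i = of_real k (tilted_coef t i).
Proof. exact: coef_form_of_coef. Qed.

Lemma ord2P (j : 'I_2) : j = ord0 \/ j = ord_max.
Proof. by case: j => -[|[|//]] h; [left|right]; apply: val_inj. Qed.

Lemma sqr_weight t j : 0 < t < 1 / 2 ->
  weight t j ^+ 2 = 1 / 2 + (-1) ^+ j * t.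
Proof.
move=> t01; rewrite sqr_sqrtr//; case: (ord2P j) => -> /=; lra.
Qed.

Lemma weight_gt0 t j : 0 < t < 1 / 2 -> 0 < weight t j.
Proof.
move=> t01; rewrite sqrtr_gt0; case: (ord2P j) => -> /=; lra.
Qed.

End HadamardPath.

Section Operators.
Variables (R : realType) (k : scalars) (H : hilbertSpace R k).
Local Notation K := (field_of R k).

(** The vector that enters the operator in front of position 0 when the earlier
    index is [j]: the sum over all later indices, with the signs of the path. *)
Definition chain n (X : 'I_n -> 'I_2 -> {linear H -> H}) (v : H)
    (j : 'I_2) : H :=
  \sum_(i : {ffun 'I_n -> 'I_2}) of_real k (hpath R j i)
    *: (\big[comp/idfun]_(s < n) (X s (i s) : H -> H)) v.

Lemma chain0 (X : 'I_0 -> 'I_2 -> {linear H -> H}) v j : chain X v j = v.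
Proof.
rewrite /chain; have [i ->] := big_ffun0 (fun i : {ffun 'I_0 -> 'I_2} =>
  of_real k (hpath R j i)
    *: (\big[comp/idfun]_(s < 0) (X s (i s) : H -> H)) v).
by rewrite big_ord0 rmorph1 scale1r.
Qed.

Lemma comp_ffcons n (X : 'I_n.+1 -> 'I_2 -> {linear H -> H}) v l i :
  (\big[comp/idfun]_(s < n.+1) (X s (ffcons l i s) : H -> H)) v =
  X ord0 l ((\big[comp/idfun]_(s < n) (X (lift ord0 s) (i s) : H -> H)) v).
Proof.
rewrite big_ord_recl /= ffcons0; congr (X ord0 l _).
by congr (_ v); apply: eq_bigr => s _; rewrite ffcons_lift.
Qed.

Lemma hpath_ffcons n l (i : {ffun 'I_n -> 'I_2}) :
  hpath R l (fun s => ffcons l i (lift ord0 s)) = hpath R l i.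
Proof.
by congr hpath; apply/funext => s; rewrite ffcons_lift.
Qed.

Lemma chainS n (X : 'I_n.+1 -> 'I_2 -> {linear H -> H}) v j :
  chain X v j = \sum_l of_real k (hadamard R j l)
    *: X ord0 l (chain (fun s => X (lift ord0 s)) v l).
Proof.
rewrite /chain big_ffun_recl; apply: eq_bigr => l _.
rewrite linear_sum scaler_sumr; apply: eq_bigr => i _.
by rewrite comp_ffcons /= ffcons0 hpath_ffcons rmorphM linearZ scalerA.
Qed.

Lemma operator_value_tilted n (t : R)
    (X : 'I_n.+1 -> 'I_2 -> {linear H -> H}) v :
  operator_value (tilted_form k n t) X v =
  \sum_j of_real k (weight t j * Num.sqrt 2 ^- n.+1)
    *: X ord0 j (chain (fun s => X (lift ord0 s)) v j).
Proof.
rewrite /operator_value big_ffun_recl; apply: eq_bigr => l _.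
rewrite linear_sum scaler_sumr; apply: eq_bigr => i _.
rewrite comp_ffcons coef_tilted_form /tilted_coef ffcons0 hpath_ffcons.
by rewrite rmorphM linearZ scalerA.
Qed.

Lemma opnorm_le1P (X : H -> H) :
  (forall v, rnorm v <= 1 -> rnorm (X v) <= 1) -> (opnorm X <= 1)%E.
Proof.
by move=> X1; apply: ge_ereal_sup => _ /= [v v1 <-]; rewrite lee_fin X1.
Qed.

Lemma opnorm_contraction (X : {linear H -> H}) :
  (opnorm X <= 1)%E -> forall v, rnorm (X v) <= rnorm v.
Proof.
move=> X1 v; have [v0|v0] := eqVneq (rnorm v) 0.
  have /eqP : `|v| = 0 by rewrite -of_rnorm v0 rmorph0.
  by rewrite normr_eq0 => /eqP ->; rewrite linear0.
have vp : 0 < rnorm v by rewrite lt_neqAle eq_sym v0 rnorm_ge0.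
have : ((rnorm (X (of_real k (rnorm v)^-1 *: v)))%:E <= 1)%E.
  apply: le_trans X1; apply: ereal_sup_ubound => /=; eexists => //=.
  by rewrite rnormZ rnorm_of_real ger0_norm ?invr_ge0 ?rnorm_ge0// mulVf.
rewrite linearZ lee_fin /= rnormZ rnorm_of_real ger0_norm ?invr_ge0 ?rnorm_ge0//.
by rewrite ler_pdivrMl// mulr1.
Qed.

Lemma parallelogram (u v : H) :
  rnorm (u + v) ^+ 2 + rnorm (u - v) ^+ 2 = 2 * (rnorm u ^+ 2 + rnorm v ^+ 2).
Proof.
apply: (can_inj (@of_realK R k)).
rewrite rmorphM !rmorphD !rmorphXn /= !of_rnorm !hilbert_normE rmorph1.
rewrite !linearDl !linearDr !linearNl !linearNr /=.
ring.
Qed.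

(** The matrix [h / sqrt 2] is orthogonal, which for two vectors of [H] is the
    parallelogram law. *)
Lemma sum_hadamard (u : 'I_2 -> H) :
  \sum_j rnorm (\sum_l of_real k (hadamard R j l) *: u l) ^+ 2 =
  2 * \sum_l rnorm (u l) ^+ 2.
Proof.
rewrite /hadamard !big_ord_recl !big_ord0 !addr0 /=.
rewrite !muln0 !mul0n !muln1 !expr0 expr1 rmorphN1 rmorph1 !scale1r scaleN1r.
exact: parallelogram.
Qed.

Lemma sum_chain_le n (X : 'I_n -> 'I_2 -> {linear H -> H}) v :
  (forall s j x, rnorm (X s j x) <= rnorm x) ->
  \sum_j rnorm (chain X v j) ^+ 2 <= 2 ^+ n.+1 * rnorm v ^+ 2.
Proof.
elim: n X => [|n IH] X X1.
  by rewrite !big_ord_recl big_ord0 !chain0 addr0 expr1 mulrDl !mul1r.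
under eq_bigr do rewrite chainS.
rewrite sum_hadamard exprS -mulrA ler_wpM2l//.
apply: le_trans (IH (fun s => X (lift ord0 s)) _) => [|s j x//].
by apply: ler_sum => l _; rewrite lerXn2r ?nnegrE ?rnorm_ge0.
Qed.

(** Cauchy-Schwarz for the unit vector [(a_0, a_1)] against the pair of norms
    controlled by [sum_chain_le]. *)
Lemma operator_value_tilted_le n (t : R)
    (X : 'I_n.+1 -> 'I_2 -> {linear H -> H}) v :
  0 < t < 1 / 2 -> (forall s j x, rnorm (X s j x) <= rnorm x) ->
  rnorm (operator_value (tilted_form k n t) X v) <= rnorm v.
Proof.
move=> t01 X1; rewrite operator_value_tilted.
apply: le_trans (ler_rnorm_sum _) _.
set Y := chain _ _.
have s0 : 0 < Num.sqrt 2 ^+ n.+1 :> R by rewrite exprn_gt0// sqrtr_gt0.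
apply: (@le_trans _ _ (Num.sqrt 2 ^- n.+1 * \sum_j weight t j * rnorm (Y j))).
  rewrite mulr_sumr; apply: ler_sum => j _.
  have w0 := ltW (weight_gt0 j t01).
  have s1 : 0 <= (Num.sqrt 2 ^+ n.+1)^-1 :> R by rewrite invr_ge0 ltW.
  rewrite rnormZ rnorm_of_real ger0_norm; last exact: mulr_ge0.
  by rewrite mulrAC [leLHS]mulrC ler_wpM2l// ler_wpM2l.
rewrite ler_pdivrMl//.
have YS : \sum_j rnorm (Y j) ^+ 2 <= (Num.sqrt 2 ^+ n.+1 * rnorm v) ^+ 2.
  rewrite exprMn -exprM mulnC exprM sqr_sqrtr//.
  by apply: sum_chain_le => s j x; apply: X1.
rewrite -(ler_pXn2r (_ : (0 < 2)%N))// ?nnegrE ?mulr_ge0 ?(ltW s0) 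
  ?rnorm_ge0//; last first.
  by apply: sumr_ge0 => j _; rewrite mulr_ge0 ?rnorm_ge0 ?ltW ?weight_gt0.
apply: le_trans YS.
have W : \sum_j weight t j ^+ 2 = 1.
  rewrite !big_ord_recl big_ord0 !sqr_weight//=; lra.
move: W; rewrite !big_ord_recl !big_ord0 !addr0.
set a := weight _ _; set b := weight _ _; set x := rnorm _; set y := rnorm _.
move=> W; have := sqr_ge0 (a * y - b * x); nra.
Qed.

End Operators.

Lemma cb_norm_tilted_le (R : realType) k n (t : R) : 0 < t < 1 / 2 ->
  (cb_norm (tilted_form k n t) <= 1)%E.
Proof.
move=> t01; apply: ge_ereal_sup => _ /= [H [X [X1 ->]]].
apply: opnorm_le1P => v v1.
apply: le_trans v1; apply: operator_value_tilted_le => // s j.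
exact: opnorm_contraction.
Qed.

(** * The norm is attained by rotations of the plane *)

Section Attained.
Variables (R : realType) (k : scalars).
Local Notation P := (plane_hilbert R k).

Definition rotation (z : R[i]) (w : P) : P := z * (w : R[i]).

Lemma rotation_is_linear (z : R[i]) : linear (rotation z).
Proof.
move=> a u v; rewrite /rotation mulrDr; congr (_ + _).
by rewrite -[a *: u]/(embed a * u) -[RHS]/(embed a * (z * u)) mulrCA.
Qed.

HB.instance Definition _ (z : R[i]) := GRing.isLinear.Build _ P P _ (rotation z)
  (rotation_is_linear z).

Lemma rotation_contraction (z : R[i]) :
  normc z = 1 -> (opnorm (rotation z : {linear P -> P}) <= 1)%E.
Proof.
move=> z1; apply: opnorm_le1P => v v1; rewrite rnorm_plane.
by rewrite [normc _]ComplexField.Normc.normcM z1 mul1r -(@rnorm_plane R k).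
Qed.

Lemma mulcJ (z : R[i]) : z * conjc z = ((normc z) ^+ 2)%:C%C.
Proof. by rewrite -sqr_normc rmorphXn normc_def; case: z. Qed.

Lemma normcJ (z : R[i]) : normc (conjc z) = normc z.
Proof. by case: z => a b /=; rewrite sqrrN. Qed.

Definition rotations n (x : 'I_n -> 'I_2 -> R[i]) s j : {linear P -> P} :=
  rotation (x s j).

Definition unimodular_family n (x : 'I_n -> 'I_2 -> R[i]) :=
  forall s j, normc (x s j) = 1.

Definition family_cons n (u : 'I_2 -> R[i]) (x : 'I_n -> 'I_2 -> R[i])
  (s : 'I_n.+1) : 'I_2 -> R[i] := if unlift ord0 s is Some s' then x s' else u.

Lemma chain_family_cons n u (x : 'I_n -> 'I_2 -> R[i]) j :
  chain (rotations (family_cons u x)) (1 : R[i]) j =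
  \sum_l (hadamard R j l)%:C%C * (u l * chain (rotations x) (1 : R[i]) l)
  :> R[i].
Proof.
have tailE : (fun s => rotations (family_cons u x) (lift ord0 s)) = rotations x.
  apply/funext => s; apply/funext => l.
  by rewrite /rotations /family_cons liftK.
rewrite chainS tailE; apply: eq_bigr => l _.
rewrite -[LHS]/(embed (of_real k _) * (_ * _)) embed_of_real.
by rewrite /family_cons unlift_none.
Qed.

Lemma unimodular_family_cons n u (x : 'I_n -> 'I_2 -> R[i]) :
  (forall j, normc (u j) = 1) -> unimodular_family x ->
  unimodular_family (family_cons u x).
Proof. by move=> u1 x1 s j; rewrite /family_cons; case: unliftP. Qed.

(** The pair of partial sums at the vector 1 has the largest norm allowed by
    [sum_chain_le], equally distributed between the two indices. *)
Definition balanced n (x : 'I_n -> 'I_2 -> R[i]) (tau : 'I_2 -> R[i]) :=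
  forall j, normc (tau j) = 1 /\
    chain (rotations x) (1 : R[i]) j = (Num.sqrt 2 ^+ n)%:C%C * tau j :> R[i].

(** Rotating back by the phases [tau] and then by [u] makes the next pair of
    partial sums the Hadamard transform of an arbitrary pair of phases. *)
Lemma chain_steer n (x : 'I_n -> 'I_2 -> R[i]) (tau u : 'I_2 -> R[i]) j :
  balanced x tau ->
  chain (rotations (family_cons (fun l => u l * conjc (tau l)) x))
    (1 : R[i]) j =
  (Num.sqrt 2 ^+ n)%:C%C * \sum_l (hadamard R j l)%:C%C * u l :> R[i].
Proof.
move=> xb; rewrite chain_family_cons mulr_sumr; apply: eq_bigr => l _.
have [t1 ->] := xb l; have := mulcJ (tau l); rewrite t1 expr1n => tJ.
rewrite [RHS]mulrCA; congr (_ * _).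
transitivity ((Num.sqrt 2 ^+ n)%:C%C * u l * (tau l * conjc (tau l))).
  by ring.
by rewrite tJ mulr1.
Qed.

Lemma steer_unimodular (tau u : 'I_2 -> R[i]) j :
  normc (tau j) = 1 -> normc (u j) = 1 -> normc (u j * conjc (tau j)) = 1.
Proof.
by move=> t1 u1; rewrite ComplexField.Normc.normcM normcJ t1 u1 mulr1.
Qed.

(** The phases [1, i] are orthogonal in the plane, so their sum and their
    difference have equal norms, and the balance propagates. *)
Lemma exists_balanced n : exists (x : 'I_n -> 'I_2 -> R[i]) tau,
  unimodular_family x /\ balanced x tau.
Proof.
elim: n => [|n [x [tau [x1 xb]]]].
  exists (fun _ _ => 1), (fun=> 1); split=> [[]//|j].
  by rewrite ComplexField.Normc.normc1 chain0 expr0 mulr1.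
pose u (l : 'I_2) : R[i] := if l == ord0 then 1 else 'i%C.
have u1 l : normc (u l) = 1.
  by rewrite /u; case: ifP => _ /=; rewrite expr0n expr1n ?addr0 ?add0r sqrtr1.
exists (family_cons (fun l => u l * conjc (tau l)) x).
exists (fun j => (Num.sqrt 2)^-1%:C%C * \sum_l (hadamard R j l)%:C%C * u l).
have s2 : Num.sqrt 2 != 0 :> R by rewrite gt_eqF// sqrtr_gt0.
split=> [|j].
  apply: unimodular_family_cons => // l.
  by apply: steer_unimodular => //; case: (xb l).
rewrite (chain_steer _ _ xb); split; last first.
  rewrite mulrA -rmorphM /= exprSr -mulrA mulfV// mulr1.
  by [].
rewrite !big_ord_recl big_ord0 addr0 /u /hadamard /=.
rewrite muln0 muln1 expr0.
have [->|->] := ord2P j; rewrite ?expr0 ?expr1; simpc.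
  by rewrite exprVn sqr_sqrtr// -div1r -splitr sqrtr1.
by rewrite sqrrN exprVn sqr_sqrtr// -div1r -splitr sqrtr1.
Qed.

(** Two unit vectors at an angle of cosine [2t] have sum and difference of norms
    [2 a_0] and [2 a_1]; the first operator then aligns these two vectors. *)
Lemma operator_value_tilted_attained n (t : R) : 0 < t < 1 / 2 ->
  exists x : 'I_n.+2 -> 'I_2 -> R[i], unimodular_family x /\
    operator_value (tilted_form k n.+1 t) (rotations x) (1 : R[i]) = (1 : R[i]).
Proof.
move=> t01; have [x [tau [x1 xb]]] := exists_balanced n.
pose u (l : 'I_2) : R[i] :=
  if l == ord0 then 1 else Complex (2 * t) (Num.sqrt (1 - (2 * t) ^+ 2)).
have t2 : 0 <= 1 - (2 * t) ^+ 2 by nra.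
have u1 l : normc (u l) = 1.
  rewrite /u; case: ifP => _ /=; first by rewrite expr0n expr1n addr0 sqrtr1.
  by rewrite sqr_sqrtr// addrC subrK sqrtr1.
pose sigma j := \sum_l (hadamard R j l)%:C%C * u l.
have sigmaE j : normc (sigma j) = 2 * weight t j.
  have w0 := weight_gt0 j t01.
  apply/eqP; rewrite -(eqrXn2 (_ : 0 < 2)%N)//; last 2 first.
  - by rewrite -(@rnorm_plane R k) rnorm_ge0.
  - by rewrite mulr_ge0// ltW.
  rewrite exprMn sqr_weight// /sigma !big_ord_recl big_ord0 addr0 /u /hadamard.
  have [->|->] := ord2P j; rewrite /= ?muln0 ?muln1 ?expr0 ?expr1; simpc => /=.
  - by rewrite sqr_sqrtr ?addr_ge0 ?sqr_ge0// sqr_sqrtr//; apply/eqP; field.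
  - by rewrite sqr_sqrtr ?addr_ge0 ?sqr_ge0// sqrrN sqr_sqrtr//; apply/eqP; field.
pose y := family_cons (fun l => u l * conjc (tau l)) x.
pose v j : R[i] := conjc (sigma j) * (2 * weight t j)^-1%:C%C.
have w2 j : 2 * weight t j != 0 by rewrite gt_eqF// mulr_gt0// weight_gt0.
exists (family_cons v y); split.
  apply: unimodular_family_cons => [j|].
    rewrite ComplexField.Normc.normcM normcJ sigmaE /= expr0n addr0 sqrtr_sqr.
    by rewrite ger0_norm ?mulfV// invr_ge0 mulr_ge0// ltW// weight_gt0.
  apply: unimodular_family_cons => // l; apply: steer_unimodular => //.
  by case: (xb l).
have tailE : (fun s => rotations (family_cons v y) (lift ord0 s)) = rotations y.
  apply/funext => s; apply/funext => l.
  by rewrite /rotations /family_cons liftK.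
have termE j : of_real k (weight t j * Num.sqrt 2 ^- n.+2)
    *: rotations (family_cons v y) ord0 j (chain (rotations y) (1 : R[i]) j) =
    (weight t j ^+ 2)%:C%C :> R[i].
  rewrite (chain_steer _ _ xb) -/(sigma j).
  rewrite -[LHS]/(embed (of_real k _) * (_ * _)) embed_of_real.
  rewrite /family_cons unlift_none.
  have := mulcJ (sigma j); rewrite sigmaE /v => sJ.
  set a := _%:C%C; set b := _%:C%C; set c := _%:C%C.
  transitivity (a * c * b * (sigma j * conjc (sigma j))); first by ring.
  rewrite sJ -!rmorphM; congr (_%:C%C).
  have s2 : Num.sqrt 2 != 0 :> R by rewrite gt_eqF// sqrtr_gt0.
  have sn : Num.sqrt 2 ^+ n != 0 :> R by rewrite expf_neq0.
  have -> : Num.sqrt 2 ^- n.+2 = (2 * Num.sqrt 2 ^+ n)^-1 :> R.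
    by rewrite !exprS mulrA -expr2 sqr_sqrtr.
  have := w2 j; rewrite mulf_eq0 negb_or => /andP[_ w0].
  field; rewrite sn w0; lra.
rewrite operator_value_tilted tailE.
transitivity (\sum_j (weight t j ^+ 2)%:C%C : R[i]).
  by apply: eq_bigr => j _; exact: termE.
rewrite -rmorph_sum !big_ord_recl big_ord0 !sqr_weight//=.
by rewrite -(rmorph1 (real_complex R)); congr (_%:C%C); field.
Qed.

End Attained.

Lemma cb_norm_tilted (R : realType) k n (t : R) : 0 < t < 1 / 2 ->
  cb_norm (tilted_form k n.+1 t) = 1%E.
Proof.
move=> t01; apply/eqP; rewrite eq_le cb_norm_tilted_le//=.
have [x [x1 xv]] := operator_value_tilted_attained k n t01.
apply: (@le_trans _ _
  (opnorm (operator_value (tilted_form k n.+1 t) (rotations k x)))).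
  apply: ereal_sup_ubound => /=; exists (1 : R[i]) => /=.
    by rewrite rnorm_plane ComplexField.Normc.normc1.
  by rewrite xv rnorm_plane ComplexField.Normc.normc1.
apply: ereal_sup_ubound => /=; exists (plane_hilbert R k), (rotations k x).
by split=> // s j; apply: rotation_contraction.
Qed.

(** * Chains and paths have a small coefficient *)

Section Approximants.
Variables (R : realType) (k : scalars) (n : nat).
Local Notation K := (field_of R k).
Local Notation d := n.+2.

(** There are only two indices, so a box has side one or is full; in the former
    case the second coordinate alone can leave the box. *)
Lemma box_dichotomy m (J : 'I_d -> {set 'I_2}) : equal_sided_box m J ->
  (exists i : {ffun 'I_d -> 'I_2},
      i ord0 = ord0 /\ ~~ [forall s, i s \in J s]) \/
  (m = 2 /\ forall s, J s = [set: 'I_2]).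
Proof.
move=> [m1 Jm]; have : (m <= 2)%N.
  by rewrite -(Jm ord0) -[leqRHS]card_ord max_card.
rewrite leq_eqVlt => /orP[/eqP m2|m2].
  right; split=> // s; apply/eqP; rewrite eqEcard finset.subsetT.
  by rewrite cardsT card_ord (Jm s) m2.
left; have [l lJ] : exists l, l \notin J (lift ord0 ord0).
  apply/existsP; rewrite -negb_forall; apply/forallP => JT.
  have := subset_leq_card (_ : [set: 'I_2] \subset J (lift ord0 ord0)).
  rewrite cardsT card_ord Jm leqNgt m2 => /(_ _)/negP; apply => //.
  by apply/fintype.subsetP => l _.
exists [ffun s => if s == ord0 then ord0 else l]; rewrite ffunE; split=> //.
by apply/forallPn; exists (lift ord0 ord0); rewrite ffunE.
Qed.

Lemma prod_path (F : 'I_d -> R) :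
  \prod_(r < d | (r.+1 < d)%N) F r =
  \prod_(r < n.+1) F (widen_ord (leqnSn _) r).
Proof.
rewrite big_mkcond big_ord_recr /= ltnn mulr1; apply: eq_bigr => r _.
by rewrite /= ltnS ltn_ord.
Qed.

Lemma flat_unimodular_path_small_coef (P : mform R k 2 d) :
  flat_unimodular_path P ->
  exists i : {ffun 'I_d -> 'I_2},
    i ord0 = ord0 /\ rnorm (coef P i : K) <= Num.sqrt 2 ^- d.+1.
Proof.
move=> [m [J [H [mJ Hu PE]]]].
have s0 : 0 <= Num.sqrt 2 ^- d.+1 :> R by rewrite invr_ge0 exprn_ge0.
have [[i [i0 iJ]]|[m2 JT]] := box_dichotomy mJ.
  by exists i; split=> //; rewrite PE (negbTE iJ) rnorm0.
exists [ffun=> ord0]; rewrite ffunE; split=> //.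
rewrite PE ifT; last by apply/forallP => s; rewrite JT inE.
rewrite rnormM rnorm_of_real rnorm_prod big1 => [|r rd]; last first.
  by rewrite Hu ?JT ?inE.
rewrite mulr1 m2 ger0_norm ?powR_ge0// powRN.
rewrite (_ : d.+1%:R / 2 = 2^-1 * d.+1%:R); last by rewrite mulrC.
by rewrite powRrM powR12_sqrt// powR_mulrn.
Qed.

(** The squared moduli in a row sum to one, so one of the two is at most 1/2. *)
Lemma unitary_small_entry (U : 'I_2 -> 'I_2 -> K) j :
  unitary_on [set: 'I_2] [set: 'I_2] U ->
  exists l, rnorm (U j l) <= (Num.sqrt 2)^-1.
Proof.
move=> [/(_ j j (finset.in_setT _) (finset.in_setT _)) + _]; rewrite eqxx.
have normJ (z : K) : z * conjugate R k z = of_real k (rnorm z ^+ 2).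
  rewrite rmorphXn /= of_rnorm /conjugate /field_of; case: k z => [z|z] /=.
    by rewrite real_normK ?num_real// expr2.
  by rewrite sqr_normc.
under eq_bigr do rewrite normJ.
rewrite -rmorph_sum /= => /(congr1 (@real_part R k)); rewrite of_realK.
rewrite -(rmorph1 (@of_real R k)) of_realK => U1.
have s2 : 0 < (Num.sqrt 2)^-1 :> R by rewrite invr_gt0 sqrtr_gt0.
have ss : (Num.sqrt 2)^-1 ^+ 2 = 1 / 2 :> R by rewrite exprVn sqr_sqrtr// div1r.
have [?|h0] := lerP (rnorm (U j ord0)) (Num.sqrt 2)^-1; first by exists ord0.
have [?|h1] := lerP (rnorm (U j (lift ord0 ord0))) (Num.sqrt 2)^-1.
  by exists (lift ord0 ord0).
move: U1; under eq_bigl do rewrite inE.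
rewrite !big_ord_recl big_ord0 addr0; nra.
Qed.

Lemma unitary_chain_small_coef (Q : mform R k 2 d) :
  unitary_chain Q ->
  exists i : {ffun 'I_d -> 'I_2},
    i ord0 = ord0 /\ rnorm (coef Q i : K) <= Num.sqrt 2 ^- d.+1.
Proof.
move=> [m [J [U [mJ Uu QE]]]].
have s0 : 0 <= Num.sqrt 2 ^- d.+1 :> R by rewrite invr_ge0 exprn_ge0.
have [[i [i0 iJ]]|[m2 JT]] := box_dichotomy mJ.
  by exists i; split=> //; rewrite QE (negbTE iJ) rnorm0.
pose small r j := [pick l | rnorm (U r j l) <= (Num.sqrt 2)^-1].
pose next (r : nat) (j : 'I_2) : 'I_2 := odflt ord0 (small (inord r : 'I_d) j).
(* The path is built greedily, a small entry being chosen in each row reached. *)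
pose g := fix g r := if r is r'.+1 then next r' (g r') else ord0.
exists [ffun s : 'I_d => g s]; rewrite ffunE; split=> //.
rewrite QE ifT; last by apply/forallP => s; rewrite JT inE.
rewrite rnormM rnorm_prod prod_path m2.
have -> : rnorm (2%:R^-1 : K) = 2^-1.
  rewrite (_ : 2%:R^-1 = of_real k 2^-1); last by rewrite fmorphV rmorph_nat.
  by rewrite rnorm_of_real ger0_norm.
apply: (@le_trans _ _ (2^-1 * \prod_(r < n.+1) (Num.sqrt 2)^-1)).
  rewrite ler_wpM2l//; apply: ler_prod => r _; rewrite rnorm_ge0/= !ffunE.
  have rd : (r.+1 < d)%N by rewrite ltnS ltn_ord.
  have -> : ordS (widen_ord (leqnSn n.+1) r) = r.+1 :> nat.
    by rewrite /= modn_small.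
  rewrite /= /next.
  rewrite -[X in inord X]/(nat_of_ord (widen_ord (leqnSn n.+1) r)) inord_val.
  rewrite /small; case: pickP => //= noU.
  have := Uu (widen_ord (leqnSn n.+1) r) rd; rewrite !JT => /unitary_small_entry.
  by move=> /(_ (g r))[l]; rewrite noU.
rewrite prodr_const card_ord exprVn [leRHS](_ : _ = 2^-1 * Num.sqrt 2 ^- n.+1)//.
by rewrite !exprS mulrA -expr2 sqr_sqrtr// invfM.
Qed.

Lemma coef_norm_ge q (T : ('I_d -> 'rV[K]_2) -> K) i : 0 < q ->
  rnorm (coef T i) <= coef_norm q T.
Proof.
move=> q0; rewrite /coef_norm -[leLHS](@powRr1 _ _ (rnorm_ge0 _)).
rewrite -(mulfV (negbT (gt_eqF q0))) powRrM.
apply: ge0_ler_powR; rewrite ?nnegrE ?invr_ge0 ?powR_ge0 ?(ltW q0)//.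
  by apply: sumr_ge0 => j _; apply: powR_ge0.
by rewrite (bigD1 i)//= lerDl sumr_ge0// => j _; apply: powR_ge0.
Qed.

Lemma rnorm_tilted_coef (t : R) (i : {ffun 'I_d -> 'I_2}) : 0 < t < 1 / 2 ->
  `|tilted_coef t i| = weight t (i ord0) * Num.sqrt 2 ^- d.
Proof.
move=> t01; rewrite /tilted_coef normrM norm_hpath mulr1 ger0_norm//.
by rewrite mulr_ge0 ?invr_ge0 ?exprn_ge0// ltW// weight_gt0.
Qed.

(** The triangle inequality at the single coefficient [i]; the constant comes
    from [sqrt (1 + 2t) >= 1 + 2t/3]. *)
Lemma tilted_far q (t : R) (T : ('I_d -> 'rV[K]_2) -> K) (Q : mform R k 2 d) :
  0 < t < 1 / 2 -> 0 < q ->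
  (forall i, coef T i = of_real k (tilted_coef t i)) ->
  (exists i : {ffun 'I_d -> 'I_2},
    i ord0 = ord0 /\ rnorm (coef Q i : K) <= Num.sqrt 2 ^- d.+1) ->
  2 / 3 * Num.sqrt 2 ^- d.+1 * t <= coef_norm q (T \- Q).
Proof.
move=> t01 q0 TE [i [i0 Qi]].
apply: le_trans (coef_norm_ge _ i q0).
have -> : coef (T \- Q) i = coef T i - coef Q i by [].
have := ler_rnormD (coef T i - coef Q i) (coef Q i); rewrite subrK.
rewrite [in leLHS]TE rnorm_of_real rnorm_tilted_coef// i0 => TQ.
have s0 : 0 < Num.sqrt 2 ^- d.+1 :> R by rewrite invr_gt0 exprn_gt0// sqrtr_gt0.
have s2 : 0 < Num.sqrt 2 :> R by rewrite sqrtr_gt0.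
have ss : Num.sqrt 2 ^+ 2 = 2 :> R by rewrite sqr_sqrtr.
have sE : Num.sqrt 2 ^- d = Num.sqrt 2 * Num.sqrt 2 ^- d.+1 :> R.
  by rewrite [in RHS]exprS [in RHS]invfM mulVKf// gt_eqF.
have w0 := weight_gt0 ord0 t01; have := sqr_weight ord0 t01.
rewrite expr0 mul1r => w2.
have : 1 + 2 / 3 * t <= weight t ord0 * Num.sqrt 2.
  rewrite -(ler_pXn2r (_ : (0 < 2)%N))// ?nnegrE; last 2 first.
  - lra.
  - by rewrite mulr_ge0// ltW.
  rewrite exprMn w2 ss; nra.
move: TQ Qi; rewrite sE mulrA; nra.
Qed.

End Approximants.

(** * Expansions modulo the fourth power *)

Section Jets.
Variable R : realType.
Implicit Types f g : R -> R.

Definition near_bounded f := exists M, forall x, `|x| <= 1 / 4 -> `|f x| <= M.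

(** Agreement of the Taylor polynomials of degree three at 0, with a remainder
    uniform on the fixed interval [|x| <= 1/4]. *)
Definition jet3_eq f g :=
  exists C, forall x, `|x| <= 1 / 4 -> `|f x - g x| <= C * x ^+ 4.

Lemma jet3_eq_trans g f h : jet3_eq f g -> jet3_eq g h -> jet3_eq f h.
Proof.
move=> [C fg] [D gh]; exists (C + D) => x x1.
rewrite -(subrKA (g x)) mulrDl (le_trans (ler_normD _ _))// lerD ?fg ?gh//.
Qed.

Lemma jet3_eq_sym f g : jet3_eq f g -> jet3_eq g f.
Proof. by move=> [C fg]; exists C => x x1; rewrite distrC fg. Qed.

Lemma jet3_eqD f1 f2 g1 g2 : jet3_eq f1 g1 -> jet3_eq f2 g2 ->
  jet3_eq (fun x => f1 x + f2 x) (fun x => g1 x + g2 x).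
Proof.
move=> [C fg1] [D fg2]; exists (C + D) => x x1.
by rewrite opprD addrACA mulrDl (le_trans (ler_normD _ _))// lerD ?fg1 ?fg2.
Qed.

Lemma jet3_eqN f g :
  jet3_eq f g -> jet3_eq (fun x => f (- x)) (fun x => g (- x)).
Proof.
move=> [C fg]; exists C => x x1.
have := fg (- x); rewrite normrN => /(_ x1).
by have -> : (- x) ^+ 4 = x ^+ 4 by ring.
Qed.

Lemma jet3_eq_bounded f g : jet3_eq f g -> near_bounded g -> near_bounded f.
Proof.
move=> [C fg] [M gM]; exists (`|C| + M) => x x1.
rewrite -(subrK (g x) (f x)) (le_trans (ler_normD _ _))// lerD ?gM//.
apply: le_trans (fg x x1) _; apply: le_trans (ler_norm _) _.
rewrite normrM ler_piMr// normrX exprn_ile1//.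
by apply: le_trans x1 _; lra.
Qed.

Lemma near_boundedM f g : near_bounded f -> near_bounded g ->
  near_bounded (fun x => f x * g x).
Proof.
move=> [M fM] [N gN]; exists (M * N) => x x1.
by rewrite normrM ler_pM ?fM ?gN.
Qed.

Lemma near_boundedX f n : near_bounded f -> near_bounded (fun x => f x ^+ n).
Proof.
move=> fb; elim: n => [|n IH]; first by exists 1 => x _; rewrite expr0 normr1.
under eq_fun do rewrite exprS; exact: near_boundedM.
Qed.

Lemma jet3_eqM f1 f2 g1 g2 : near_bounded g1 -> near_bounded g2 ->
  jet3_eq f1 g1 -> jet3_eq f2 g2 ->
  jet3_eq (fun x => f1 x * f2 x) (fun x => g1 x * g2 x).
Proof.
move=> b1 [M2 b2] fg1 [D fg2]; have [M1 f1M] := jet3_eq_bounded fg1 b1.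
case: fg1 => C fg1; exists (M1 * D + C * M2) => x x1.
have -> : f1 x * f2 x - g1 x * g2 x =
  f1 x * (f2 x - g2 x) + (f1 x - g1 x) * g2 x by ring.
have -> : (M1 * D + C * M2) * x ^+ 4 =
  M1 * (D * x ^+ 4) + C * x ^+ 4 * M2 by ring.
rewrite (le_trans (ler_normD _ _))// !normrM.
by rewrite lerD// ler_pM ?f1M ?fg2 ?fg1 ?b2.
Qed.

Lemma jet3_eqX f g n : near_bounded g -> jet3_eq f g ->
  jet3_eq (fun x => f x ^+ n) (fun x => g x ^+ n).
Proof.
move=> gb fg; elim: n => [|n IH].
  by exists 0 => x _; rewrite !expr0 subrr normr0 mul0r.
under eq_fun do rewrite exprS; under [X in jet3_eq _ X]eq_fun do rewrite exprS.
by apply: jet3_eqM => //; exact: near_boundedX.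
Qed.

Definition cubic (a b c x : R) := 1 + a * x + b * x ^+ 2 + c * x ^+ 3.

Lemma near_bounded_cubic a b c : near_bounded (cubic a b c).
Proof.
exists (1 + `|a| + `|b| + `|c|) => x x1; rewrite /cubic.
have mx u m : `|u * x ^+ m| <= `|u|.
  rewrite normrM ler_piMr// normrX exprn_ile1//; apply: le_trans x1 _; lra.
apply: le_trans (ler_normD _ _) _; apply: lerD => //.
apply: le_trans (ler_normD _ _) _; apply: lerD => //.
apply: le_trans (ler_normD _ _) _; apply: lerD; first by rewrite normr1.
by rewrite -[x]expr1.
Qed.

Lemma cubicM_jet a b c a' b' c' :
  jet3_eq (fun x => cubic a b c x * cubic a' b' c' x)
    (cubic (a + a') (b + a * a' + b') (c + b * a' + a * b' + c')).
Proof.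
exists (`|a * c' + b * b' + c * a'| + `|b * c' + c * b'| + `|c * c'|) => x x1.
have -> : cubic a b c x * cubic a' b' c' x -
    cubic (a + a') (b + a * a' + b') (c + b * a' + a * b' + c') x =
  ((a * c' + b * b' + c * a') + (b * c' + c * b') * x + (c * c') * x ^+ 2) * x ^+ 4.
  by rewrite /cubic; ring.
have x4 : 0 <= x ^+ 4 by rewrite (exprM x 2 2) sqr_ge0.
have mx u m : `|u * x ^+ m| <= `|u|.
  rewrite normrM ler_piMr// normrX exprn_ile1//; apply: le_trans x1 _; lra.
rewrite normrM (ger0_norm x4) ler_wpM2r//.
apply: le_trans (ler_normD _ _) _; apply: lerD => //.
apply: le_trans (ler_normD _ _) _; apply: lerD => //.
by rewrite -[x in _ * x]expr1.
Qed.

Lemma cubicX_jet a b c n : jet3_eq (fun x => cubic a b c x ^+ n)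
  (cubic (n%:R * a) (n%:R * b + n%:R * (n%:R - 1) / 2 * a ^+ 2)
    (n%:R * c + n%:R * (n%:R - 1) * a * b
     + n%:R * (n%:R - 1) * (n%:R - 2) / 6 * a ^+ 3)).
Proof.
elim: n => [|n IH].
  exists 0 => x _; rewrite expr0 (_ : 1 - _ = 0) ?normr0 ?mul0r// /cubic.
  by field.
under eq_fun do rewrite exprS.
apply: (@jet3_eq_trans (fun x => cubic a b c x * cubic (n%:R * a)
  (n%:R * b + n%:R * (n%:R - 1) / 2 * a ^+ 2)
    (n%:R * c + n%:R * (n%:R - 1) * a * b
     + n%:R * (n%:R - 1) * (n%:R - 2) / 6 * a ^+ 3) x)).
  apply: jet3_eqM => //; try exact: near_bounded_cubic.
  by exists 0 => x _; rewrite subrr normr0 mul0r.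
have [C CE] := cubicM_jet a b c (n%:R * a)
  (n%:R * b + n%:R * (n%:R - 1) / 2 * a ^+ 2)
    (n%:R * c + n%:R * (n%:R - 1) * a * b
     + n%:R * (n%:R - 1) * (n%:R - 2) / 6 * a ^+ 3).
exists C => x x1; have := CE x x1; congr (`|_ - _| <= _).
rewrite -natr1; congr cubic; by field.
Qed.

(** The factorization of [u^(n+1) - v^(n+1)] by [u - v] has a cofactor bounded
    below by [c^n]; this extracts roots without differentiating them. *)
Lemma jet3_eq_root f g n (c : R) : 0 < c ->
  (forall x, `|x| <= 1 / 4 -> 0 <= f x) ->
  (forall x, `|x| <= 1 / 4 -> c <= g x) ->
  jet3_eq (fun x => f x ^+ n.+1) (fun x => g x ^+ n.+1) -> jet3_eq f g.
Proof.
move=> c0 f0 gc [C fg]; exists (C / c ^+ n) => x x1.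
have g0 : 0 <= g x by rewrite (le_trans (ltW c0))// gc.
rewrite mulrAC ler_pdivlMr ?exprn_gt0//; apply: le_trans (fg x x1).
rewrite subrXX normrM ler_wpM2l// big_ord_recr /= subnn expr0 mul1r.
have gn : c ^+ n <= g x ^+ n by rewrite lerXn2r ?nnegrE ?gc// ltW.
apply: le_trans gn (le_trans _ (ler_norm _)); rewrite lerDr.
by apply: sumr_ge0 => i _; rewrite mulr_ge0 ?exprn_ge0 ?f0.
Qed.

End Jets.

Section PowerMean.
Variables (R : realType) (d : nat).
Local Notation p := (d.+1%:R / d.+2%:R : R).

(** The binomial series of [(1+x)^p]: both sides raised to the power [d+2] have
    the jet of [(1+x)^(d+1)]. *)
Lemma powR_cubic_jet : jet3_eq (fun x : R => (1 + x) `^ p)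
  (cubic p (- (p * (1 - p) / 2)) (p * (1 - p) * (2 - p) / 6)).
Proof.
have d0 : 0 < d.+2%:R :> R by rewrite ltr0n.
have dE : d.+1%:R = d.+2%:R - 1 :> R by rewrite -[d.+2%:R]natr1 addrK.
have p01 : 0 < p < 1.
  apply/andP; split; first by rewrite divr_gt0 ?ltr0n.
  by rewrite ltr_pdivrMr// mul1r ltr_nat.
have x1P (x : R) : `|x| <= 1 / 4 -> 0 <= 1 + x.
  by rewrite ler_norml => x1; lra.
apply: (@jet3_eq_root _ _ _ d.+1 (1 / 2)) => //.
- by move=> x x1; exact: powR_ge0.
- move=> x; rewrite /cubic; set q := p in p01 *; rewrite ler_norml => x1.
  have q1 : 0 <= q * (1 - q) <= 1 / 4.
    by have := sqr_ge0 (q - 1 / 2); nra.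
  have q2 : 0 <= q * (1 - q) * (2 - q) <= 1 / 2.
    by move: (q * (1 - q)) q1 => r q1; nra.
  have x2 : 0 <= x ^+ 2 <= 1 / 16 by rewrite expr2; nra.
  have x3 : - (1 / 64) <= x ^+ 3 <= 1 / 64.
    by rewrite exprS; move: (x ^+ 2) x2 => y x2; nra.
  have t1 : - (1 / 4) <= q * x by nra.
  have t2 : q * (1 - q) / 2 * x ^+ 2 <= 1 / 8.
    by move: (q * (1 - q)) (x ^+ 2) q1 x2 => r y q1 x2; nra.
  have t3 : - (1 / 16) <= q * (1 - q) * (2 - q) / 6 * x ^+ 3.
    by move: (q * (1 - q) * (2 - q)) (x ^+ 3) q2 x3 => r y q2 x3; nra.
  lra.
apply: (@jet3_eq_trans _ (fun x => cubic 1 0 0 x ^+ d.+1)).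
  exists 0 => x x1; rewrite mul0r normr_le0 subr_eq0; apply/eqP.
  rewrite -powR_mulrn ?powR_ge0// -powRrM divfK ?gt_eqF//.
  by rewrite powR_mulrn ?x1P// /cubic !mul0r !addr0 mul1r.
apply: jet3_eq_trans (cubicX_jet _ _ _ _) _; apply: jet3_eq_sym.
apply: jet3_eq_trans (cubicX_jet _ _ _ _) _.
exists 0 => x _; rewrite mul0r normr_le0 subr_eq0; apply/eqP.
rewrite dE; congr cubic; field; exact: lt0r_neq0.
Qed.

Definition power_mean (x : R) := ((1 + x) `^ p + (1 - x) `^ p) / 2.

Lemma power_mean_jet :
  jet3_eq power_mean (cubic 0 (- (p * (1 - p) / 2)) 0).
Proof.
have H := jet3_eqD powR_cubic_jet (jet3_eqN powR_cubic_jet).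
case: H => C H; exists (C / 2) => x x1.
rewrite [leRHS]mulrAC ler_pdivlMr// -[X in _ * X](@ger0_norm _ 2)// -normrM.
apply: le_trans (H x x1); rewrite /power_mean /cubic.
rewrite le_eqVlt; apply/orP; left; apply/eqP; congr (`|_|).
by field; rewrite -natrD pnatr_eq0.
Qed.

Lemma power_mean_ge0 x : 0 <= power_mean x.
Proof. by rewrite divr_ge0// addr_ge0// powR_ge0. Qed.

(** Odd terms cancel in the mean, so only the coefficient of [x^2] matters:
    [(p (1-p) / 2) / (2p) = (1-p) / 4]. *)
Lemma power_mean_root_jet :
  jet3_eq (fun x => power_mean x `^ (d.+2%:R / (2 * d.+1)%:R))
    (cubic 0 (- ((1 - p) / 4)) 0).
Proof.
have d0 : 0 < d.+2%:R :> R by rewrite ltr0n.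
have dE : d.+1%:R = d.+2%:R - 1 :> R by rewrite -[d.+2%:R]natr1 addrK.
have p01 : 0 < p < 1.
  apply/andP; split; first by rewrite divr_gt0 ?ltr0n.
  by rewrite ltr_pdivrMr// mul1r ltr_nat.
apply: (@jet3_eq_root _ _ _ (2 * d.+1).-1 (1 / 2)) => //.
- by move=> x _; exact: powR_ge0.
- move=> x; rewrite /cubic; set q := p in p01 *; rewrite ler_norml => x1.
  have x2 : 0 <= x ^+ 2 <= 1 / 16 by rewrite expr2; nra.
  move: (x ^+ 2) x2 => y x2; nra.
rewrite prednK//.
apply: (@jet3_eq_trans _ (fun x => power_mean x ^+ d.+2)).
  exists 0 => x x1; rewrite mul0r normr_le0 subr_eq0; apply/eqP.
  rewrite -powR_mulrn ?powR_ge0// -powRrM divfK ?powR_mulrn ?power_mean_ge0//.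
apply: jet3_eq_trans (jet3_eqX _ _ power_mean_jet) _.
  exact: near_bounded_cubic.
apply: jet3_eq_trans (cubicX_jet _ _ _ _) _; apply: jet3_eq_sym.
apply: jet3_eq_trans (cubicX_jet _ _ _ _) _.
exists 0 => x _; rewrite mul0r normr_le0 subr_eq0; apply/eqP.
rewrite natrM dE; congr cubic; by field; rewrite -?natrD ?pnatr_eq0.
Qed.

End PowerMean.

(** * Deficit of the tilted form and failure of large exponents *)

Section Deficit.
Variables (R : realType) (n : nat).
Local Notation d := n.+2.
Local Notation q := ((2 * d)%:R / d.+1%:R : R).
Local Notation mean := (power_mean n.+1 : R -> R).

Definition mean_norm (t : R) := mean (2 * t) `^ (d.+1%:R / (2 * d)%:R).

Lemma tilted_term_powR (t : R) (j : 'I_2) : 0 < t < 1 / 2 ->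
  (weight t j * Num.sqrt 2 ^- d) `^ q =
  (1 + (-1) ^+ j * (2 * t)) `^ (d%:R / d.+1%:R) * 2 ^- d.
Proof.
move=> t01.
have x0 : 0 <= 1 + (-1) ^+ j * (2 * t).
  by case: (ord2P j) => -> /=; lra.
have -> : weight t j * Num.sqrt 2 ^- d =
    (1 + (-1) ^+ j * (2 * t)) `^ 2^-1 * 2 `^ (- (2^-1 * d.+1%:R)).
  rewrite powRN powRrM !powR12_sqrt// powR_mulrn//.
  rewrite [in RHS]exprS [in RHS]invfM [RHS]mulrA.
  congr (_ * _); rewrite -sqrtrV// -sqrtrM//.
  by congr Num.sqrt; field.
rewrite powRM ?powR_ge0// -!powRrM; congr (_ * _).
  by congr powR; rewrite natrM; field; rewrite -?natrD ?pnatr_eq0.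
rewrite (_ : _ * _ = - d%:R); last first.
  by rewrite natrM; field; rewrite -?natrD ?pnatr_eq0.
by rewrite powRN powR_mulrn.
Qed.

Lemma coef_norm_tilted k (t : R)
    (T : ('I_d -> 'rV[field_of R k]_2) -> field_of R k) :
  0 < t < 1 / 2 -> (forall i, coef T i = of_real k (tilted_coef t i)) ->
  coef_norm q T = mean_norm t.
Proof.
move=> t01 TE; rewrite /coef_norm /mean_norm invf_div; congr (_ `^ _).
under eq_bigr do rewrite TE rnorm_of_real rnorm_tilted_coef// tilted_term_powR//.
rewrite big_ffun_recl.
under eq_bigr => j _ do under eq_bigr do rewrite ffcons0.
under eq_bigr do rewrite sumr_const card_ffun !card_ord.
rewrite [LHS]sumrMnl -[LHS]mulr_natl natrX.
rewrite !big_ord_recl big_ord0 addr0 /power_mean expr0 mul1r /= expr1 mulN1r.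
have s0 : 2 ^+ n.+1 != 0 :> R by rewrite expf_neq0.
rewrite [2 ^+ d]exprS; field; exact: s0.
Qed.

(** The expansion modulo [x^4] at [x = 2t] covers [t <= 1/8], and its quadratic
    term is [(1-p) / 4 * (2t)^2 = t^2 / (d+1)]; for larger [t] everything is
    bounded and the remainder absorbs it. *)
Lemma mean_norm_expansion : exists C : R, forall t : R, 0 < t < 1 / 2 ->
  `|1 - mean_norm t - t ^+ 2 / d.+1%:R| <= C * t ^+ 4.
Proof.
have [C CE] := power_mean_root_jet R n.+1.
exists (`|C| * 16 + 4 * 8 ^+ 4) => t t01.
have t4 : 0 <= t ^+ 4 by rewrite exprn_ge0//; lra.
have [t8|t8] := lerP t (1 / 8).
  have x1 : `|2 * t| <= 1 / 4 by rewrite ger0_norm; lra.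
  have dE : n.+3%:R = n.+2%:R + 1 :> R by rewrite natr1.
  have -> : 1 - mean_norm t - t ^+ 2 / d.+1%:R = - (mean_norm t
      - cubic 0 (- ((1 - n.+2%:R / n.+3%:R) / 4)) 0 (2 * t)).
    by rewrite /cubic dE; field; rewrite -?natrD ?natr1 ?pnatr_eq0.
  rewrite normrN; apply: le_trans (CE _ x1) _.
  rewrite exprMn; have := ler_norm C; nra.
have m0 (x : R) : 0 <= x -> x <= 2 -> x `^ (n.+2%:R / n.+3%:R) <= 2.
  move=> x0 x2; apply: (@le_trans _ _ (2 `^ (n.+2%:R / n.+3%:R))).
    by rewrite ge0_ler_powR// nnegrE.
  rewrite -[leRHS]powRr1// ler_powR ?ler1n// ler_pdivrMr ?ltr0n// mul1r ler_nat//.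
have M2 : mean (2 * t) <= 2.
  have := m0 (1 + 2 * t); have := m0 (1 - 2 * t).
  rewrite /power_mean; lra.
have N2 : mean_norm t <= 2.
  rewrite /mean_norm; apply: (@le_trans _ _ (2 `^ (d.+1%:R / (2 * d)%:R))).
    by rewrite ge0_ler_powR// nnegrE// power_mean_ge0.
  rewrite -[leRHS]powRr1// ler_powR ?ler1n// ler_pdivrMr ?ltr0n// mul1r ler_nat//.
  by lia.
have N0 : 0 <= mean_norm t by rewrite powR_ge0.
have D1 : 0 <= t ^+ 2 / d.+1%:R <= 1.
  rewrite divr_ge0 ?sqr_ge0//= ler_pdivrMr ?ltr0n// mul1r.
  have d1 : 1 <= d.+1%:R :> R by rewrite ler1n.
  by apply: le_trans d1; rewrite expr2; nra.
have t1 : 1 <= 8 ^+ 4 * t ^+ 4 by rewrite -exprMn exprn_ege1//; lra.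
apply: (@le_trans _ _ 4).
  by move: (mean_norm t) (t ^+ 2 / _) N0 N2 D1 => x y; rewrite ler_norml; lra.
by move: (t ^+ 4) t4 t1 => y; have := normr_ge0 C; nra.
Qed.

End Deficit.

Section NoUniformEstimate.
Variables (R : realType) (n : nat) (k : scalars).
Local Notation d := n.+2.
Local Notation q := ((2 * d)%:R / d.+1%:R : R).

Lemma small_powR (c D beta tau : R) : 0 < c -> 0 < beta -> 0 < tau ->
  exists t, 0 < t <= tau /\ D * t `^ beta < c.
Proof.
move=> c0 b0 tau0; pose e := c / (`|D| + 1).
have D0 : 0 < `|D| + 1 by rewrite ltr_wpDl.
have e0 : 0 < e by rewrite divr_gt0.
exists (Num.min tau (e `^ beta^-1)).
have ep : 0 < e `^ beta^-1 by rewrite powR_gt0.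
rewrite lt_min tau0 ep ge_min lexx; split=> //.
set t := Num.min _ _.
have t0 : 0 < t by rewrite lt_min tau0.
have te : t `^ beta <= e.
  apply: (@le_trans _ _ ((e `^ beta^-1) `^ beta)).
    by rewrite ge0_ler_powR ?nnegrE ?(ltW t0) ?(ltW b0) ?(ltW ep)//
      ge_min lexx orbT.
  by rewrite -powRrM mulVf ?gt_eqF// powRr1// ltW.
have tp : 0 < t `^ beta by rewrite powR_gt0.
have eE : e * (`|D| + 1) = c by rewrite divfK// gt_eqF.
have := ler_norm D; have := normr_ge0 D; nra.
Qed.

(** The form [T_t] has deficit at most [A t^2], so the estimate would give
    [c t <= C (A t^2)^alpha], that is, [c <= C A^alpha t^(2 alpha - 1)]. *)
Lemma no_uniform_estimate (S : forall m, mform R k m d -> Prop) (c alpha : R) :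
  0 < c -> 1 / 2 < alpha ->
  (forall (t : R) (Q : mform R k 2 d), 0 < t < 1 / 2 -> S 2 Q ->
     c * t <= coef_norm q (tilted_form k n.+1 t \- Q)) ->
  ~ uniform_estimate q alpha S.
Proof.
move=> c0 a2 far [C [eps0 [eps00 H]]].
have [B BE] := mean_norm_expansion R n.
pose A := `|B| + 1.
have A1 : 1 <= A by rewrite lerDr.
have A0 : 0 < A by rewrite (lt_le_trans _ A1).
have tau0 : 0 < Num.min (1 / 4) (eps0 / A).
  by rewrite lt_min; apply/andP; split; rewrite divr_gt0.
have b0 : 0 < alpha * 2 - 1 by lra.
have [t [/andP[t0]]] := small_powR (C * A `^ alpha) c0 b0 tau0.
rewrite le_min => /andP[t4 tA] tc.
have t01 : 0 < t < 1 / 2 by lra.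
have tE i : coef (tilted_form k n.+1 t) i = of_real k (tilted_coef t i).
  exact: coef_tilted_form.
have N := coef_norm_tilted t01 tE.
have def : 1 - A * t ^+ 2 <= coef_norm q (tilted_form k n.+1 t).
  rewrite N; have := BE t t01; rewrite ler_norml => /andP[_].
  have : t ^+ 2 / d.+1%:R <= t ^+ 2.
    by rewrite ler_pdivrMr ?ltr0n// ler_peMr ?sqr_ge0// ler1n.
  have t2 : 0 <= t ^+ 2 by rewrite sqr_ge0.
  have : B * t ^+ 4 <= `|B| * t ^+ 2.
    apply: (@le_trans _ _ (`|B| * t ^+ 4)).
      by rewrite ler_wpM2r ?ler_norm// exprn_ge0// ltW.
    by rewrite ler_wpM2l// ler_wiXn2l//; lra.
  rewrite /A mulrDl mul1r.
  move: (mean_norm n t) (t ^+ 2 / _) (B * _) (`|B| * _) => x y z w; lra.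
have epsP : 0 <= A * t ^+ 2 <= eps0.
  rewrite mulr_ge0 ?sqr_ge0 ?(ltW A0)//=.
  move: tA; rewrite ler_pdivlMr// => tA; apply: le_trans tA.
  by rewrite mulrC ler_wpM2r ?(ltW A0)// expr2; nra.
have [Q [QS]] :=
  H 2 _ (tilted_form k n.+1 t) isT epsP (cb_norm_tilted k n t01) def.
move=> hi; have := le_trans (far _ _ t01 QS) hi.
have -> : (A * t ^+ 2) `^ alpha = A `^ alpha * t `^ (alpha * 2 - 1) * t.
  rewrite powRM ?sqr_ge0 ?(ltW A0)// -mulrA; congr (_ * _).
  rewrite -powR_mulrn ?(ltW t0)// -powRrM -[X in _ = _ * X]powRr1 ?(ltW t0)//.
  rewrite -powRD ?subrK 1?mulrC//.
  by apply/implyP => _; rewrite gt_eqF.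
by rewrite !mulrA ler_pM2r// => /le_lt_trans/(_ tc); rewrite ltxx.
Qed.

End NoUniformEstimate.

Theorem proposition10p1 (R : realType) (d : nat) (hd : (2 <= d)%N) :
  let q : R := (2 * d)%:R / d.+1%:R in
  (exists T : R -> mform R RealScalars 2 d,
     [/\ forall t, 0 < t < 1 / 2 -> cb_norm (T t) = 1%E,
         exists C : R, forall t, 0 < t < 1 / 2 ->
           `|1 - coef_norm q (T t) - t ^+ 2 / d.+1%:R| <= C * t ^+ 4 &
         exists c t0 : R,
           [/\ 0 < c, 0 < t0 <= 1 / 2 &
               forall t, 0 < t < t0 ->
                 [/\ forall Q : mform R RealScalars 2 d, unitary_chain Q ->
                       c * t <= coef_norm q (T t \- Q),
                     forall P : mform R RealScalars 2 d,
                       flat_unimodular_path P ->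
                       c * t <= coef_norm q (T t \- P),
                     forall Q : mform R ComplexScalars 2 d, unitary_chain Q ->
                       c * t <= coef_norm q (complexify (T t) \- Q) &
                     forall P : mform R ComplexScalars 2 d,
                       flat_unimodular_path P ->
                       c * t <= coef_norm q (complexify (T t) \- P)]]]) /\
  (forall (k : scalars) (alpha : R), 1 / 2 < alpha ->
     ~ uniform_estimate q alpha (fun n => @unitary_chain R k n d) /\
     ~ uniform_estimate q alpha (fun n => @flat_unimodular_path R k n d)).
Proof.
case: d hd => [//|[//|n _]] q.
have q0 : 0 < q by rewrite divr_gt0 ?ltr0n.
pose c : R := 2 / 3 * Num.sqrt 2 ^- n.+3.
have c0 : 0 < c by rewrite mulr_gt0 ?divr_gt0// invr_gt0 exprn_gt0// sqrtr_gt0.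
have tE k t i : coef (tilted_form k n.+1 t) i =
    of_real k (tilted_coef t i) :> field_of R k.
  exact: coef_tilted_form.
split=> [|k alpha a2]; last first.
  split; apply: (no_uniform_estimate c0 a2) => t Q t01 QS.
    by apply: tilted_far => //; exact: unitary_chain_small_coef.
  by apply: tilted_far => //; exact: flat_unimodular_path_small_coef.
exists (fun t => tilted_form RealScalars n.+1 t); split.
- by move=> t t01; exact: cb_norm_tilted.
- have [C CE] := mean_norm_expansion R n; exists C => t t01.
  by rewrite (coef_norm_tilted t01 (tE _ t)) CE.
have cE t i : coef (complexify (tilted_form RealScalars n.+1 t)) i =
    of_real ComplexScalars (tilted_coef t i) :> field_of R ComplexScalars.
  by rewrite [LHS]coef_form_of_coef tE.
exists c, (1 / 2); split=> //; first by rewrite lexx andbT; lra.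
move=> t t01; split=> Q QS; apply: tilted_far => //.
- exact: unitary_chain_small_coef.
- exact: flat_unimodular_path_small_coef.
- exact: unitary_chain_small_coef.
- exact: flat_unimodular_path_small_coef.
Qed.
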